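(* Let $\boldsymbol\mu$ be a $q\times p$ matrix of measures whose step-line moment matrix has the Gauss--Borel factorization $\mathscr M=\mathscr L^{-1}\mathscr U^{-1}$, where $\mathscr L$ is lower unitriangular and $\mathscr U$ is (nonsingular) upper triangular, and suppose that the associated recurrence matrix has the two representations \[ T=\mathscr L\,\mathsf\Lambda_{[q]}\,\mathscr L^{-1}=\mathscr U^{-1}\,\mathsf\Lambda_{[p]}^{\mathsf T}\,\mathscr U . \] Put $\xi=\mathsf E_{[q]}\mathscr L\mathsf E_{[q]}^{\mathsf T}$ and $\nu^{\mathsf T}=\mathsf E_{[p]}\mathscr U\mathsf E_{[p]}^{\mathsf T}$. Then \[ \mathcal O_q(T;\xi^{-1})=\mathscr L^{-1},\qquad \mathcal O_p(T^{\mathsf T};\nu^{-1})=\mathscr U^{-\mathsf T}. \] Consequently, \[ \mathscr M=\mathcal O_q(T;\xi^{-1})\,\mathcal O_p(T^{\mathsf T};\nu^{-1})^{\mathsf T}. \] Moreover, the complete coefficient arrays of the two step-line mixed-type polynomial matrices $\boldsymbol B(x)=\mathscr L\boldsymbol\chi_{[q]}(x)$ and $\boldsymbol A(x)=\boldsymbol\chi_{[p]}(x)^{\mathsf T}\mathscr U$ are respectively \[ \mathscr L=\mathcal O_q(T;\xi^{-1})^{-1},\qquad \mathscr U^{\mathsf T}=\mathcal O_p(T^{\mathsf T};\nu^{-1})^{-1}. \]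
   Context: Let $p,q\ge1$. All semi-infinite matrices are indexed by $\mathbb N_0$. The step-line moment matrix of a $q\times p$ matrix of measures $\boldsymbol\mu=(\mu_{j,i})$, $0\le j<q$, $0\le i<p$, with finite moments, is $\mathscr M_{qu+j,pv+i}=\int x^{u+v}\,\mathrm d\mu_{j,i}(x)$, $u,v\in\mathbb N_0$. $\mathsf E_{[r]}=[\,I_r\ 0\ 0\cdots]$ is the projection onto the first $r$ coordinates. $\boldsymbol\chi_{[r]}(x)$ is the semi-infinite-by-$r$ matrix obtained by stacking the blocks $I_r,xI_r,x^2I_r,\dots$, and $\mathsf\Lambda_{[r]}$ is the block shift ($(\mathsf\Lambda_{[r]})_{i,i+r}=1$, all other entries $0$), so that $\mathsf\Lambda_{[r]}\boldsymbol\chi_{[r]}(x)=x\boldsymbol\chi_{[r]}(x)$. For a semi-infinite matrix $S$, an integer $r\ge1$ and a nonsingular $r\times r$ matrix $C$, the normalized block output matrix $\mathcal O_r(S;C)$ is the semi-infinite matrix whose $n$-th block row (of $r$ rows), $n\in\mathbb N_0$, is $C\,\mathsf E_{[r]}S^n$. The notation $X^{-\mathsf T}$ means $(X^{-1})^{\mathsf T}$. *)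

(* Defs.v *)
From HB Require Import structures.
From mathcomp Require Import all_boot all_order all_algebra.
From mathcomp Require Import all_classical all_reals all_analysis.

Set Implicit Arguments.
Unset Strict Implicit.
Unset Printing Implicit Defensive.

Import Order.TTheory GRing.Theory Num.Theory.
Import numFieldNormedType.Exports.

Local Open Scope classical_set_scope.
Local Open Scope ring_scope.

(* A matrix with possibly infinite index types is a plain function
   I -> J -> R: I and J are nat in a semi-infinite direction and 'I_r in a
   finite one. *)

(* The sum is over the finite support of k |-> A i k * B k j. As usual with
   \sum_(k \in _), it is 0 by convention when that support is infinite; all
   the products of triangular or banded matrices below have finite sums. *)
Definition smul (R : nzRingType) (I J : Type) (K : choiceType)
    (A : I -> K -> R) (B : K -> J -> R) : I -> J -> R :=
  fun i j => \sum_(k \in [set: K]) (A i k * B k j).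

Notation "A *oo B" := (smul A B) (at level 40, left associativity) : ring_scope.

Definition strmx (R I J : Type) (A : I -> J -> R) : J -> I -> R :=
  fun j i => A i j.

Definition sone (R : nzRingType) : nat -> nat -> R := fun i j => (i == j)%:R.

Definition sexp (R : nzRingType) (S : nat -> nat -> R) (n : nat) :
  nat -> nat -> R := iter n (smul S) (sone R).

Definition is_sinv (R : nzRingType) (A B : nat -> nat -> R) : Prop :=
  A *oo B = sone R /\ B *oo A = sone R.

Definition nonsingular (R : nzRingType) (A : nat -> nat -> R) : Prop :=
  exists B, is_sinv A B.

(* A two-sided inverse of A if there is one, and the zero matrix otherwise.
   The inverse of a nonsingular triangular matrix is unique. *)
Definition sinv (R : nzRingType) (A : nat -> nat -> R) : nat -> nat -> R :=
  xget (fun _ _ => 0) [set B | is_sinv A B].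

Definition lower_triangular (R : nzRingType) (A : nat -> nat -> R) : Prop :=
  forall i j, (i < j)%N -> A i j = 0.

Definition upper_triangular (R : nzRingType) (A : nat -> nat -> R) : Prop :=
  lower_triangular (strmx A).

Definition lower_unitriangular (R : nzRingType) (A : nat -> nat -> R) : Prop :=
  lower_triangular A /\ forall i, A i i = 1.

(* E_[r] *)
Definition Eproj (R : nzRingType) (r : nat) : 'I_r -> nat -> R :=
  fun i k => (i == k :> nat)%:R.
Arguments Eproj : clear implicits.

(* Lambda_[r] *)
Definition block_shift (R : nzRingType) (r : nat) : nat -> nat -> R :=
  fun i j => (j == i + r)%N%:R.
Arguments block_shift : clear implicits.

(* chi_[r](x), with x the polynomial indeterminate: the row r * n + i is the
   row i of the block x^n I_r. *)
Definition chi (R : nzRingType) (r : nat) : nat -> 'I_r -> {poly R} :=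
  fun k i => if (k %% r == i)%N then 'X^(k %/ r) else 0.
Arguments chi : clear implicits.

(* E_[r] S E_[r]^T *)
Definition leading_block (R : nzRingType) (r : nat) (S : nat -> nat -> R) :
  'M[R]_r := \matrix_(i, j) (Eproj R r *oo S *oo strmx (Eproj R r)) i j.

Definition ord_mod (r : nat) (hr : (0 < r)%N) (k : nat) : 'I_r :=
  Ordinal (ltn_pmod k hr).

(* O_r(S; C): the row r * n + i is the row i of C E_[r] S^n. *)
Definition block_output (R : nzRingType) (r : nat) (hr : (0 < r)%N)
    (S : nat -> nat -> R) (C : 'M[R]_r) : nat -> nat -> R :=
  fun k j =>
    ((fun a b => C a b) *oo Eproj R r *oo sexp S (k %/ r)) (ord_mod hr k) j.

Definition finite_moments (R : realType)
    (mu : {measure set (measurableTypeR R) -> \bar R}) : Prop :=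
  forall n : nat, mu.-integrable [set: measurableTypeR R]
                    (fun x : measurableTypeR R => ((x : R) ^+ n)%:E).

Definition moment (R : realType)
    (mu : {measure set (measurableTypeR R) -> \bar R}) (n : nat) : R :=
  Rintegral mu [set: measurableTypeR R]
    (fun x : measurableTypeR R => (x : R) ^+ n).

(* The entry (q u + j, p v + i) is the moment of order u + v of mu_{j,i}. *)
Definition moment_matrix (R : realType) (p q : nat)
    (hp : (0 < p)%N) (hq : (0 < q)%N)
    (mu : 'I_q -> 'I_p -> {measure set (measurableTypeR R) -> \bar R}) :
  nat -> nat -> R :=
  fun k l => moment (mu (ord_mod hq k) (ord_mod hp l)) (k %/ q + l %/ p).

Definition spolyC (R : nzRingType) (A : nat -> nat -> R) :
  nat -> nat -> {poly R} := fun i j => (A i j)%:P.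

(* B(x) = L chi_[q](x) and A(x) = chi_[p](x)^T U *)
Definition Bpoly (R : nzRingType) (q : nat) (L : nat -> nat -> R) :
  nat -> 'I_q -> {poly R} := spolyC L *oo chi R q.
Arguments Bpoly {R} q L.

Definition Apoly (R : nzRingType) (p : nat) (U : nat -> nat -> R) :
  'I_p -> nat -> {poly R} := strmx (chi R p) *oo spolyC U.
Arguments Apoly {R} p U.

(* The complete coefficient array of a family of polynomial rows
   P_n(x) = sum_u P_{n,u} x^u, with P_{n,u} of size 1 x r, has for n-th row
   the concatenation P_{n,0} P_{n,1} P_{n,2} ... *)
Definition coef_array (R : nzRingType) (r : nat) (hr : (0 < r)%N)
    (P : nat -> 'I_r -> {poly R}) : nat -> nat -> R :=
  fun n k => (P n (ord_mod hr k))`_(k %/ r).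

(* Main.v *)
Require Import Defs.
From HB Require Import structures.
From mathcomp Require Import all_boot all_order all_algebra.
From mathcomp Require Import all_classical all_reals all_analysis.

Set Implicit Arguments.
Unset Strict Implicit.
Unset Printing Implicit Defensive.

Import Order.TTheory GRing.Theory Num.Theory.
Import numFieldNormedType.Exports.

Local Open Scope classical_set_scope.
Local Open Scope ring_scope.

(** Conjugating a block shift by a lower triangular [L] gives
    [T^n = L Lambda^n L^-1]. The first [r] rows of [L Lambda^n L^-1] only see
    the leading block [xi] of [L], so that [xi^-1 E T^n = E Lambda^n L^-1],
    which is the [n]-th block of rows of [L^-1]: the block output matrix of [T]
    lists the rows of [L^-1] in order ([block_output_conj]). The statement for
    [U] is the same one for the lower triangular matrix [U^T], since transposing
    the second representation of [T] gives
    [T^T = U^T Lambda_[p] (U^T)^-1]. The factorization of the moment matrix and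
    the two formulas for [L] and [U^T] then follow from involutivity of the
    inverse, and the coefficient arrays are read off the definition of [chi]
    ([coef_array_Bpoly]).

    The delicate point is that products of semi-infinite matrices are neither
    always finite sums nor always associative, and that an inverse is just some
    two-sided inverse for this product. Products are therefore reassociated
    only for row-finite left factors ([smulA]), and [lower_right_inverse] shows
    that every inverse of a lower triangular matrix is lower triangular, which
    gives uniqueness and puts the inverses in the row-finite class. *)

(** * Products with finitely many terms *)

Lemma smul_bounded (R : nzRingType) (I J : Type) (A : I -> nat -> R)
    (B : nat -> J -> R) (N : nat) i j :
    (forall k, (N <= k)%N -> A i k * B k j = 0) ->
  (A *oo B) i j = \sum_(k < N) A i k * B k j.
Proof.
move=> AB0; rewrite /smul (fsbig_ord _ _ (fun k => A i k * B k j)).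
apply/esym/fsbig_widen => // k [_ /= /negP]; rewrite -leqNgt.
exact: AB0.
Qed.

Lemma smul_ord (R : nzRingType) (I J : Type) (r : nat) (A : I -> 'I_r -> R)
    (B : 'I_r -> J -> R) i j :
  (A *oo B) i j = \sum_(k < r) A i k * B k j.
Proof.
rewrite /smul (fsbigE (index_enum 'I_r)) ?index_enum_uniq//.
- by apply: eq_bigl => k; rewrite in_setT.
- by move=> k _; rewrite mem_index_enum.
Qed.

Lemma smul_single (R : nzRingType) (I J : Type) (A : I -> nat -> R)
    (B : nat -> J -> R) i j k0 :
    (forall k, k != k0 -> A i k * B k j = 0) ->
  (A *oo B) i j = A i k0 * B k0 j.
Proof.
move=> AB0; rewrite (@smul_bounded _ _ _ _ _ k0.+1) => [|k lt_k]; last first.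
  by apply: AB0; rewrite gtn_eqF.
by rewrite big_ord_recr/= big1 ?add0r// => k _; rewrite AB0// ltn_eqF.
Qed.

(** Associativity of products can fail for arbitrary semi-infinite matrices.
    This class contains the lower triangular matrices and the block shifts,
    and is closed under products, so products in it can be reassociated. *)
Definition row_finite (R : nzRingType) (I : Type) (A : I -> nat -> R) : Prop :=
  forall i, exists N, forall k, (N <= k)%N -> A i k = 0.

Lemma row_finite_lower (R : nzRingType) (A : nat -> nat -> R) :
  lower_triangular A -> row_finite A.
Proof. by move=> lowA i; exists i.+1 => k; apply: lowA. Qed.

(** Finitely many rows of a row-finite matrix have a common bound: this is what
    makes both sides of the associativity law finite double sums. *)
Lemma row_finite_bound (R : nzRingType) (A : nat -> nat -> R) N :
    row_finite A ->
  exists M, forall k, (k < N)%N -> forall l, (M <= l)%N -> A k l = 0.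
Proof.
move=> finA; elim: N => [|N [M AM]]; first by exists 0%N.
have [M' AM'] := finA N; exists (maxn M M') => k; rewrite ltnS leq_eqVlt.
by case/orP=> [/eqP-> | ltkN] l; rewrite geq_max => /andP[??];
  [apply: AM' | apply: AM].
Qed.

Lemma row_finite_smul (R : nzRingType) (I : Type) (A : I -> nat -> R)
    (B : nat -> nat -> R) :
  row_finite A -> row_finite B -> row_finite (A *oo B).
Proof.
move=> finA finB i; have [N AN] := finA i.
have [M BM] := row_finite_bound N finB; exists M => l leMl.
rewrite (@smul_bounded _ _ _ _ _ N) => [|k /AN->]; last by rewrite mul0r.
by rewrite big1// => k _; rewrite BM// mulr0.
Qed.

(** The last factor is arbitrary: row-finiteness of the first two bounds both
    summation indices, and the two finite sums can then be exchanged. *)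
Lemma smulA (R : nzRingType) (I J : Type) (A : I -> nat -> R)
    (B : nat -> nat -> R) (C : nat -> J -> R) :
    row_finite A -> row_finite B ->
  A *oo (B *oo C) = A *oo B *oo C.
Proof.
move=> finA finB; apply/funext => i; apply/funext => j.
have [N AN] := finA i; have [M BM] := row_finite_bound N finB.
have ABE l : (A *oo B) i l = \sum_(k < N) A i k * B k l.
  by apply: smul_bounded => k /AN->; rewrite mul0r.
rewrite (@smul_bounded _ _ _ _ _ N) => [|k /AN->]; last by rewrite mul0r.
rewrite (@smul_bounded _ _ _ _ _ M) => [|l leMl]; last first.
  by rewrite ABE big1 ?mul0r// => k _; rewrite BM// mulr0.
under [RHS]eq_bigr do rewrite ABE mulr_suml.
rewrite exchange_big/=; apply: eq_bigr => k _.
rewrite (@smul_bounded _ _ _ _ _ M) => [|l leMl]; last by rewrite BM// mul0r.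
by rewrite mulr_sumr; apply: eq_bigr => l _; rewrite mulrA.
Qed.

Lemma smul1l (R : nzRingType) (J : Type) (A : nat -> J -> R) :
  sone R *oo A = A.
Proof.
apply/funext => i; apply/funext => j.
rewrite (@smul_single _ _ _ _ _ _ _ i) /sone ?eqxx ?mul1r// => k.
by rewrite eq_sym => /negPf->; rewrite mul0r.
Qed.

Lemma smul1r (R : nzRingType) (I : Type) (A : I -> nat -> R) :
  A *oo sone R = A.
Proof.
apply/funext => i; apply/funext => j.
rewrite (@smul_single _ _ _ _ _ _ _ j) /sone ?eqxx ?mulr1// => k.
by move=> /negPf->; rewrite mulr0.
Qed.

Lemma strmx_smul (R : comNzRingType) (I J : Type) (K : choiceType)
    (A : I -> K -> R) (B : K -> J -> R) :
  strmx (A *oo B) = strmx B *oo strmx A.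
Proof.
apply/funext => j; apply/funext => i; rewrite /smul /strmx.
by apply: eq_fsbigr => k _; rewrite mulrC.
Qed.

Lemma strmx_sone (R : nzRingType) : strmx (sone R) = sone R.
Proof.
by apply/funext => i; apply/funext => j; rewrite /strmx /sone eq_sym.
Qed.

Lemma is_sinv_strmx (R : comNzRingType) (A B : nat -> nat -> R) :
  is_sinv A B -> is_sinv (strmx A) (strmx B).
Proof. by case=> AB BA; split; rewrite -strmx_smul ?AB ?BA strmx_sone. Qed.

(** * Inverses of lower triangular matrices *)

Section LowerTriangular.
Variable F : fieldType.
Implicit Types A B : nat -> nat -> F.

Lemma lower_smulE A B i j :
  lower_triangular A -> (A *oo B) i j = \sum_(k < i.+1) A i k * B k j.
Proof. by move=> lowA; apply: smul_bounded => k /lowA->; rewrite mul0r. Qed.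

(** Forward substitution: once the rows of [B] above row [i] are known to be
    triangular, the entries [(i, j)], [i <= j], of [A *oo B = 1] reduce to
    [A i i * B i j = (i == j)]. Hence an inverse in the weak sense of [is_sinv],
    which does not presuppose any shape, is automatically triangular, and
    [A] has a nonzero diagonal. *)
Lemma lower_right_inverse A B : lower_triangular A -> A *oo B = sone F ->
  lower_triangular B /\ forall i, A i i * B i i = 1.
Proof.
move=> lowA AB1.
have ABE i j : \sum_(k < i) A i k * B k j + A i i * B i j = (i == j)%:R.
  rewrite -[RHS]/(sone F i j) -AB1 lower_smulE//.
  by rewrite [RHS]big_ord_recr.
suff tri i : (forall j, (i < j)%N -> B i j = 0) /\ A i i * B i i = 1.
  by split=> [i j|i]; case: (tri i) => // + _; apply.
elim/ltn_ind: i => i IHi.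
have before j : (i <= j)%N -> A i i * B i j = (i == j)%:R.
  move=> leij; rewrite -ABE big1 ?add0r// => k _.
  by rewrite (IHi k (ltn_ord k)).1 ?mulr0// (leq_trans (ltn_ord k)).
have diag : A i i * B i i = 1 by rewrite before// eqxx.
split=> // j ltij; have := before j (ltnW ltij); rewrite ltn_eqF// => /eqP.
rewrite mulf_eq0 => /orP[/eqP Aii0|/eqP//].
by move/eqP: diag; rewrite Aii0 mul0r eq_sym oner_eq0.
Qed.

(** Row [i] of the inverse is the last row of the inverse of the truncation of
    [A] to its first [i.+1] rows and columns: row [i] of [B *oo A = 1] involves
    row [i] of [B] alone, so the rows can be found independently. *)
Lemma lower_left_inverse A : lower_triangular A -> (forall i, A i i != 0) ->
  exists2 B, lower_triangular B & B *oo A = sone F.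
Proof.
move=> lowA diagA.
pose trunc i : 'M[F]_i.+1 := \matrix_(k, l) A k l.
have truncU i : trunc i \in unitmx.
  rewrite unitmxE det_trig; last by apply/is_trig_mxP => k l /lowA; rewrite mxE.
  by rewrite unitfE prodf_seq_neq0; apply/allP => k _; rewrite mxE diagA.
pose B i j := if (j < i.+1)%N then invmx (trunc i) ord_max (inord j) else 0.
have lowB : lower_triangular B by move=> i j ltij; rewrite /B ltnS leqNgt ltij.
exists B => //; apply/funext => i; apply/funext => j; rewrite lower_smulE//.
have [leji | ltij] := leqP j i; last first.
  rewrite big1 => [|k _]; first by rewrite /sone ltn_eqF.
  by rewrite lowA ?mulr0// (leq_ltn_trans _ ltij)// -ltnS.
have /matrixP/(_ ord_max (inord j)) := mulVmx (truncU i).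
rewrite !mxE -val_eqE/= inordK// /sone => <-; apply: eq_bigr => k _.
by rewrite /B ltn_ord inord_val mxE inordK.
Qed.

(** A left inverse [B] is again triangular with nonzero diagonal, so it has a
    left inverse [C] too, and associativity gives [C = A]. *)
Lemma lower_nonsingular A :
  lower_triangular A -> (forall i, A i i != 0) -> nonsingular A.
Proof.
move=> lowA diagA; have [B lowB BA1] := lower_left_inverse lowA diagA.
have [_ diagBA] := lower_right_inverse lowB BA1.
have diagB i : B i i != 0.
  by apply: contra_eq_neq (diagBA i) => ->; rewrite mul0r eq_sym oner_neq0.
have [C lowC CB1] := lower_left_inverse lowB diagB.
have CA : C = A.
  rewrite -[C]smul1r -BA1 smulA ?CB1 ?smul1l//; exact: row_finite_lower.
by exists B; split=> //; rewrite -{1}CA.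
Qed.

Lemma lower_inverse_unique A B C :
  lower_triangular A -> is_sinv A B -> is_sinv A C -> C = B.
Proof.
move=> lowA [AB1 BA1] [AC1 CA1].
have [lowC _] := lower_right_inverse lowA AC1.
rewrite -[C]smul1r -AB1 smulA ?CA1 ?smul1l//; exact: row_finite_lower.
Qed.

Lemma lower_sinvE A B : lower_triangular A -> is_sinv A B -> sinv A = B.
Proof.
move=> lowA invAB; apply: (lower_inverse_unique lowA invAB).
exact: (@xgetI _ _ [set C | is_sinv A C] B).
Qed.

Lemma sinvP A : nonsingular A -> is_sinv A (sinv A).
Proof. by case=> B invAB; apply: (@xgetI _ _ [set C | is_sinv A C] B). Qed.

Lemma lower_sinv A :
  lower_triangular A -> nonsingular A -> lower_triangular (sinv A).
Proof.
by move=> lowA /sinvP[ASA _]; case: (lower_right_inverse lowA ASA).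
Qed.

Lemma lower_sinvK A :
  lower_triangular A -> nonsingular A -> sinv (sinv A) = A.
Proof.
move=> lowA nsA; apply: lower_sinvE; first exact: lower_sinv.
by have [] := sinvP nsA; split.
Qed.

(** Lets an upper triangular factor be treated through its transpose: the
    transposed inverse inverts a lower triangular matrix, and such an inverse
    is unique. *)
Lemma upper_nonsingular_sinv A : upper_triangular A -> nonsingular A ->
  nonsingular (strmx A) /\ sinv (strmx A) = strmx (sinv A).
Proof.
move=> uppA /sinvP/is_sinv_strmx invA; split; first by exists (strmx (sinv A)).
exact: lower_sinvE.
Qed.

End LowerTriangular.

(** * Block shifts and leading blocks *)

Section BlockShift.
Variables (R : nzRingType) (J : Type) (r : nat).

Lemma block_shift_smul (A : nat -> J -> R) i j :
  (block_shift R r *oo A) i j = A (i + r)%N j.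
Proof.
rewrite (@smul_single _ _ _ _ _ _ _ (i + r)%N) /block_shift ?eqxx ?mul1r// => k.
by move=> /negPf->; rewrite mul0r.
Qed.

Lemma Eproj_smul (A : nat -> J -> R) (i : 'I_r) j :
  (Eproj R r *oo A) i j = A i j.
Proof.
rewrite (@smul_single _ _ _ _ _ _ _ i) /Eproj ?eqxx ?mul1r// => k.
by rewrite eq_sym => /negPf->; rewrite mul0r.
Qed.

End BlockShift.

Lemma row_finite_shift (R : nzRingType) r : row_finite (block_shift R r).
Proof. by move=> i; exists (i + r).+1 => k ltk; rewrite /block_shift gtn_eqF. Qed.

Lemma leading_blockE (R : nzRingType) r (S : nat -> nat -> R) (i j : 'I_r) :
  leading_block r S i j = S i j.
Proof.
rewrite mxE (@smul_single _ _ _ _ _ _ _ j) /strmx /Eproj ?eqxx ?mulr1.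
  by rewrite Eproj_smul.
by move=> k; rewrite eq_sym => /negPf->; rewrite mulr0.
Qed.

Lemma leading_block_tr (R : nzRingType) r (S : nat -> nat -> R) :
  (leading_block r S)^T = leading_block r (strmx S).
Proof. by apply/matrixP => i j; rewrite mxE !leading_blockE. Qed.

Lemma leading_block_unit (F : fieldType) r (L : nat -> nat -> F) :
  lower_triangular L -> nonsingular L -> leading_block r L \in unitmx.
Proof.
move=> lowL [L' [LL' _]]; have [_ diagL] := lower_right_inverse lowL LL'.
rewrite unitmxE det_trig; last first.
  by apply/is_trig_mxP => i j; rewrite leading_blockE; apply: lowL.
rewrite unitfE prodf_seq_neq0; apply/allP => i _ /=; rewrite leading_blockE.
by apply: contra_eq_neq (diagL i) => ->; rewrite mul0r eq_sym oner_neq0.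
Qed.

(** As [L] is lower triangular, the first [r] rows of [L] are the leading block
    of [L] followed by zeros; normalizing by the inverse of this block leaves
    the projection itself. *)
Lemma normalized_projection (F : fieldType) r (L : nat -> nat -> F) :
    lower_triangular L -> nonsingular L ->
  (fun a b => invmx (leading_block r L) a b) *oo Eproj F r *oo L = Eproj F r.
Proof.
move=> lowL nsL; set C := invmx _.
apply/funext => i; apply/funext => l.
have CE b k : ((fun a b => C a b) *oo Eproj F r) b k
              = \sum_(c < r) C b c * (c == k :> nat)%:R by rewrite smul_ord.
rewrite (@smul_bounded _ _ _ _ _ r) => [|k lek]; last first.
  rewrite CE big1 ?mul0r// => c _.
  by rewrite ltn_eqF ?mulr0// (leq_trans (ltn_ord c)).
have -> : \sum_(k < r) ((fun a b => C a b) *oo Eproj F r) i k * L k l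
          = \sum_(k < r) C i k * L k l.
  apply: eq_bigr => k _; rewrite CE (bigD1 k)//= eqxx mulr1 big1 ?addr0// => c.
  by rewrite -val_eqE => /negPf->; rewrite mulr0.
have [lerl | ltlr] := leqP r l.
  rewrite /Eproj ltn_eqF ?(leq_trans (ltn_ord i))// big1// => k _.
  by rewrite lowL ?mulr0// (leq_trans (ltn_ord k)).
have /matrixP/(_ i (Ordinal ltlr)) := mulVmx (leading_block_unit r lowL nsL).
rewrite !mxE -val_eqE/= /Eproj => <-.
by apply: eq_bigr => k _; rewrite leading_blockE.
Qed.

(** * Block outputs and coefficient arrays *)

(** The powers of a conjugate are the conjugates of the powers, and the powers
    of a block shift are longer block shifts. *)
Lemma sexp_conj_shift (F : fieldType) r (L : nat -> nat -> F) n :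
    lower_triangular L -> nonsingular L ->
  sexp (L *oo block_shift F r *oo sinv L) n
    = L *oo (block_shift F (n * r) *oo sinv L).
Proof.
move=> lowL nsL; have [LL' L'L] := sinvP nsL.
have finL := row_finite_lower lowL.
have finL' := row_finite_lower (lower_sinv lowL nsL).
have finS m := @row_finite_shift F m.
elim: n => [|n IHn].
  have -> : block_shift F (0 * r) = sone F.
    by apply/funext=> i; apply/funext=> j; rewrite /block_shift addn0 eq_sym.
  by rewrite smul1l LL'.
rewrite [LHS]/= -/(sexp _ n) IHn.
rewrite -(smulA _ (row_finite_smul finL (finS r)) finL').
rewrite (smulA _ finL' finL) L'L smul1l -(smulA _ finL (finS r)).
congr (_ *oo _).
by apply/funext=> i; apply/funext=> j; rewrite !block_shift_smul mulSn addnA.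
Qed.

(** The block [n] of the output is [C E L Lambda^n L^-1] with [C] the inverse of
    the leading block of [L]. The factor [C E L] is [E], so this block consists
    of the rows [n * r], ..., [n * r + r - 1] of [L^-1]; stacking the blocks
    restores [L^-1]. *)
Lemma block_output_conj (F : fieldType) r (hr : (0 < r)%N)
    (L : nat -> nat -> F) :
    lower_triangular L -> nonsingular L ->
  block_output hr (L *oo block_shift F r *oo sinv L)
    (invmx (leading_block r L)) = sinv L.
Proof.
move=> lowL nsL; apply/funext => k; apply/funext => j.
rewrite /block_output sexp_conj_shift// smulA; last 2 first.
- move=> i; exists r => l lerl; rewrite smul_ord big1// => c _.
  by rewrite /Eproj ltn_eqF ?mulr0// (leq_trans (ltn_ord c)).
- exact: row_finite_lower.
by rewrite normalized_projection// Eproj_smul block_shift_smul/= addnC -divn_eq.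
Qed.

(** In the product with [chi], column [k] of [L] contributes only to the
    coefficient of degree [k %/ r] of the component [k %% r], and these two
    numbers determine [k]. *)
Lemma coef_array_Bpoly (R : nzRingType) r (hr : (0 < r)%N)
    (L : nat -> nat -> R) :
  lower_triangular L -> coef_array hr (Bpoly r L) = L.
Proof.
move=> lowL; apply/funext => n; apply/funext => k.
(* The bound [n] comes from triangularity, [k] is the index that contributes. *)
rewrite /coef_array /Bpoly (@smul_bounded _ _ _ _ _ (maxn n k).+1); last first.
  by move=> l; rewrite gtn_max => /andP[/lowL + _]; rewrite /spolyC => ->;
    rewrite polyC0 mul0r.
have ltk : (k < (maxn n k).+1)%N by rewrite ltnS leq_maxr.
rewrite coef_sum (bigD1 (Ordinal ltk))//= big1 => [|l /negPf lk].
  by rewrite addr0 /spolyC /chi eqxx coefCM coefXn eqxx mulr1.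
rewrite /spolyC /chi coefCM; case: eqP => [eqm|_]; last by rewrite coef0 mulr0.
rewrite coefXn; case: eqP => [eqd|_]; last by rewrite mulr0.
by move: lk; rewrite -val_eqE/= (divn_eq l r) eqm -eqd -divn_eq eqxx.
Qed.

Theorem theorem5p1 (R : realType) (p q : nat) (hp : (0 < p)%N) (hq : (0 < q)%N)
    (mu : 'I_q -> 'I_p -> {measure set (measurableTypeR R) -> \bar R})
    (hmu : forall j i, finite_moments (mu j i))
    (L U T : nat -> nat -> R)
    (hL : lower_unitriangular L)
    (hU : upper_triangular U) (hUn : nonsingular U)
    (hM : moment_matrix hp hq mu = sinv L *oo sinv U)
    (hTL : T = L *oo block_shift R q *oo sinv L)
    (hTU : T = sinv U *oo strmx (block_shift R p) *oo U) :
  let xi : 'M[R]_q := leading_block q L in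
  let nu : 'M[R]_p := (leading_block p U)^T in
  let Oq := block_output hq T (invmx xi) in
  let Op := block_output hp (strmx T) (invmx nu) in
  [/\ xi \in unitmx /\ nu \in unitmx,
      Oq = sinv L /\ Op = strmx (sinv U),
      moment_matrix hp hq mu = Oq *oo strmx Op,
      coef_array hq (Bpoly q L) = L /\ L = sinv Oq
    & coef_array hp (strmx (Apoly p U)) = strmx U /\ strmx U = sinv Op].
Proof.
move=> xi nu Oq Op; case: hL => lowL diagL.
have nsL : nonsingular L.
  by apply: lower_nonsingular => // i; rewrite diagL oner_neq0.
have [nsUt sinvUt] := upper_nonsingular_sinv hU hUn.
have TtE : strmx T = strmx U *oo block_shift R p *oo sinv (strmx U).
  rewrite hTU !strmx_smul sinvUt smulA//; first exact: row_finite_lower.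
  exact: row_finite_shift.
have nuE : nu = leading_block p (strmx U) by exact: leading_block_tr.
have OqE : Oq = sinv L by rewrite /Oq hTL block_output_conj.
have OpE : Op = sinv (strmx U) by rewrite /Op TtE nuE block_output_conj.
split.
- by rewrite nuE; split; apply: leading_block_unit.
- by rewrite OpE sinvUt.
- by rewrite OqE OpE sinvUt.
- by rewrite coef_array_Bpoly// OqE lower_sinvK.
- rewrite /Apoly strmx_smul -[strmx (spolyC U)]/(spolyC (strmx U)).
  by rewrite OpE lower_sinvK//; split=> //; apply: coef_array_Bpoly.
Qed.
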